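(* Let $(V_1,V_2)$ and $(\tilde V_1,\tilde V_2)$ be two pure pairs of commuting isometries on Hilbert spaces $\mathcal{H}$ and $\tilde{\mathcal{H}}$, respectively. Then $(V_1,V_2)$ and $(\tilde V_1,\tilde V_2)$ are unitarily equivalent if and only if $(V_1|_{\mathcal{W}_2},\,V_2^*|_{V_2\mathcal{W}_1})$ and $(\tilde V_1|_{\tilde{\mathcal{W}}_2},\,\tilde V_2^*|_{\tilde V_2\tilde{\mathcal{W}}_1})$ are unitarily equivalent.
   Context: For commuting isometries $(V_1,V_2)$ on $\mathcal{H}$ put $V=V_1V_2$, $\mathcal{W}=\mathcal{H}\ominus V\mathcal{H}$, $\mathcal{W}_j=\mathcal{H}\ominus V_j\mathcal{H}$ ($j=1,2$); $\tilde V,\tilde{\mathcal{W}},\tilde{\mathcal{W}}_j$ are defined in the same way from $(\tilde V_1,\tilde V_2)$. The pair $(V_1,V_2)$ is called pure if $V$ is a pure isometry, i.e. $V^{*m}\to0$ in the strong operator topology. Two pairs of operators $(T_1,T_2)$ on $\mathcal{K}$ and $(\tilde T_1,\tilde T_2)$ on $\tilde{\mathcal{K}}$ are (jointly) unitarily equivalent if there is a unitary $X:\mathcal{K}\to\tilde{\mathcal{K}}$ with $XT_j=\tilde T_jX$ for $j=1,2$. One has the orthogonal decomposition $\mathcal{W}=V_2\mathcal{W}_1\oplus\mathcal{W}_2=\mathcal{W}_1\oplus V_1\mathcal{W}_2$. In the statement, $V_1|_{\mathcal{W}_2}$ and $V_2^*|_{V_2\mathcal{W}_1}$ are regarded as operators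 $C_1,C_2$ on $\mathcal{W}$, extended by zero on the orthogonal complement: $C_1(V_2\eta_1\oplus\eta_2)=V_1\eta_2$ and $C_2(V_2\eta_1\oplus\eta_2)=\eta_1$ for $\eta_1\in\mathcal{W}_1$, $\eta_2\in\mathcal{W}_2$; likewise for the tilde pair on $\tilde{\mathcal{W}}$. Thus unitary equivalence of these pairs means the existence of a unitary $Z:\mathcal{W}\to\tilde{\mathcal{W}}$ with $ZC_j=\tilde C_jZ$ for $j=1,2$. *)

(* Defs.v *)
From HB Require Import structures.
From mathcomp Require Import all_boot all_order all_algebra sesquilinear.
From mathcomp Require Import complex.
From mathcomp Require Import all_classical all_reals all_analysis.
Import numFieldNormedType.Exports.

Set Implicit Arguments.
Unset Strict Implicit.
Unset Printing Implicit Defensive.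
Import Order.TTheory GRing.Theory Num.Theory.
Local Open Scope classical_set_scope.
Local Open Scope complex_scope.
Local Open Scope ring_scope.

HB.mixin Record isHilbert (R : realType) H of CompleteNormedModule R[i] H := {
  hdot : {dot H for @Num.conj R[i]};
  hdotE : forall x : H, hdot x x = `|x| ^+ 2
}.

#[short(type="hilbertType")]
HB.structure Definition Hilbert (R : realType) :=
  {H of isHilbert R H & CompleteNormedModule R[i] H}.

Section Operators.
Variables (R : realType) (H K : hilbertType R).

Definition ortho_compl (S : set H) : set H :=
  [set x | forall y, S y -> hdot x y = 0].

(* The orthogonal projection onto S; such a point is unique when S is a
   subspace, and exists for every x when S is moreover closed. *)
Definition oproj (S : set H) (x : H) : H :=
  xget 0 [set y | S y /\ ortho_compl S (x - y)].

(* T restricted to S, extended by zero on the orthogonal complement of S. *)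
Definition restr0 (S : set H) (T : H -> K) : H -> K := T \o oproj S.

(* Such a point is unique, and exists whenever T is bounded and linear. *)
Definition adjoint (T : H -> K) (y : K) : H :=
  xget 0 [set z | forall x, hdot (T x) y = hdot x z].

Definition wandering (T : H -> H) : set H := ortho_compl (range T).

(* X is a unitary operator from the subspace S onto the subspace S'; its
   values outside S are irrelevant. *)
Definition unitary_between (S : set H) (S' : set K) (X : H -> K) :=
  [/\ forall (a : R[i]) x y, S x -> S y -> X (a *: x + y) = a *: X x + X y,
      forall x y, S x -> S y -> hdot (X x) (X y) = hdot x y &
      X @` S = S'].

End Operators.

Definition unitarily_equivalent (R : realType) (H H' : hilbertType R)
    (S : set H) (T1 T2 : H -> H) (S' : set H') (T1' T2' : H' -> H') :=
  exists X : H -> H', [/\ unitary_between S S' X,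
    forall x, S x -> X (T1 x) = T1' (X x) &
    forall x, S x -> X (T2 x) = T2' (X x)].

Section IsometricPair.
Variables (R : realType) (H : hilbertType R).

Definition isometric (V : {linear H -> H}) := forall x, `|V x| = `|x|.

(* T^{*m} tends to 0 in the strong operator topology. *)
Definition pure (T : H -> H) :=
  forall x : H, iter m (adjoint T) x @[m --> \oo] --> (0 : H).

Definition pure_pair (V1 V2 : {linear H -> H}) :=
  [/\ isometric V1, isometric V2, V1 \o V2 =1 V2 \o V1 & pure (V1 \o V2)].

Variables V1 V2 : {linear H -> H}.

Definition W := wandering (V1 \o V2).
Definition W1 := wandering V1.
Definition W2 := wandering V2.

(* On W = V2 W1 (+) W2 these are the two operators of the pair attached to
   (V1, V2); see C1E and C2E below. *)
Definition C1 := restr0 W2 V1.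
Definition C2 := restr0 (V2 @` W1) (adjoint V2).

End IsometricPair.

Section Facts.
Variables (R : realType) (H : hilbertType R).

Lemma hdot_eq0 (x : H) : hdot x x = 0 -> x = 0.
Proof. by move/eqP; rewrite hdotE sqrf_eq0 normr_eq0 => /eqP. Qed.

Lemma hdotC (x y : H) : hdot x y = (hdot y x)^*%R.
Proof. by rewrite hermC /= expr0 mul1r. Qed.

Lemma isometric_hdot (V : {linear H -> H}) : isometric V ->
  forall x y, hdot (V x) (V y) = hdot x y.
Proof.
move=> isoV x y.
have E (u : H) : hdot (V u) (V u) = hdot u u by rewrite !hdotE isoV.
have add u v : hdot (V u) (V v) + (hdot (V u) (V v))^*%R =
    hdot u v + (hdot u v)^*%R.
  have := E (u + v); rewrite linearD !dnormD /= !E.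
  by move=> /addrI.
have e1 := add x y; have := add ('i *: x) y.
rewrite linearZ /= !linearZl_LR /= !rmorphM /= conjCi !mulNr -!mulrBr.
move/(mulfI (neq0Ci _)) => e2.
move: (hdot (V x) (V y)) (hdot x y) e1 e2 => a b e1 e2.
apply: (@mulIf _ 2%:R); first by rewrite pnatr_eq0.
by rewrite !mulr_natr !mulr2n -{1}(subrK a^*%R a) addrAC -addrA e1 e2 addrA
  addrAC subrK.
Qed.

Lemma oprojE (S : set H) (s t : H) :
  (forall u v, S u -> S v -> S (u - v)) ->
  S s -> ortho_compl S t -> oproj S (t + s) = s.
Proof.
move=> subS Ss tS; apply: xget_unique; first by split=> //; rewrite addrK.
move=> y [Sy yP]; apply/eqP; rewrite -subr_eq0; apply/eqP/hdot_eq0.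
have Sd := subS _ _ Sy Ss.
rewrite {1}(_ : y - s = t - (t + s - y)); last first.
  by rewrite opprB addrCA opprD addNKr.
by rewrite linearBl /= (tS _ Sd) (yP _ Sd) subr0.
Qed.

Lemma ortho_complB (S : set H) u v :
  ortho_compl S u -> ortho_compl S v -> ortho_compl S (u - v).
Proof.
by move=> uS vS y Sy; rewrite linearBl /= uS // vS // subr0.
Qed.

Variables V1 V2 : {linear H -> H}.
Hypothesis iso2 : isometric V2.

Lemma C1E (eta1 eta2 : H) : W1 V1 eta1 -> W2 V2 eta2 ->
  C1 V1 V2 (V2 eta1 + eta2) = V1 eta2.
Proof.
move=> _ h2; rewrite /C1 /restr0 /= oprojE //; first exact: ortho_complB.
by move=> y h; rewrite hdotC h ?conjC0 //; exists eta1.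
Qed.

Lemma C2E (eta1 eta2 : H) : W1 V1 eta1 -> W2 V2 eta2 ->
  C2 V1 V2 (V2 eta1 + eta2) = eta1.
Proof.
move=> h1 h2; rewrite /C2 /restr0 /= addrC oprojE.
- apply: xget_unique => [x|z zP]; first exact: isometric_hdot.
  apply/eqP; rewrite -subr_eq0; apply/eqP/hdot_eq0.
  by rewrite linearBr /= -zP isometric_hdot // subrr.
- move=> _ _ [u hu <-] [v hv <-]; exists (u - v); last by rewrite linearB.
  exact: ortho_complB.
- by exists eta1.
- by move=> _ [u _ <-]; apply: h2; exists u.
Qed.

End Facts.

(* Main.v *)
From HB Require Import structures.
Require Import Defs.
From mathcomp Require Import all_boot all_order all_algebra.
From mathcomp Require Import sesquilinear complex ring.
From mathcomp Require Import all_classical all_reals all_analysis.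
Import numFieldNormedType.Exports.

Set Implicit Arguments.
Unset Strict Implicit.
Unset Printing Implicit Defensive.
Import Order.TTheory GRing.Theory Num.Theory.
Local Open Scope classical_set_scope.
Local Open Scope ring_scope.

(** Write V = V1 V2 and W for the wandering space of V.

    If X is a unitary carrying (V1, V2) to (V1', V2'), it carries ranges, hence
    wandering spaces, onto each other; since C1 and C2 are read off from the
    decomposition W = V2 W1 (+) W2, the restriction of X to W intertwines them.

    Conversely a unitary Z from W onto W' determines by itself a unitary X with
    X V = V' X: purity gives the Wold decomposition of H as the orthogonal sum
    of the spaces V^n W, and X must send V^n w to V'^n Z w.  So X x is the sum
    over n of V'^n Z P V*^n x, where P = 1 - V V* projects onto W
    ([wold_extension]).  Its tails are bounded by |V*^n x|, so purity gives the
    convergence; it also forces X to be isometric, because the defect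
    <X x, X y> - <x, y> is unchanged when x, y are replaced by V* x, V* y, and
    surjective, because a vector orthogonal to the range of X is orthogonal to
    every V'^n W'.

    It remains to see that X respects the factors.  On W one has
    V1 = V C2 + C1 ([V1_W]), with C1 and C2 mapping W into itself, so that X
    intertwines V1 and V1' on W.  The difference X V1 - V1' X also intertwines
    V and V', and a bounded intertwiner that vanishes on W is zero
    ([intertwiner_eq0]).  Cancelling the injective V1' in
    V1' X V2 = X V = V' X = V1' V2' X gives the statement for V2.

    All of this rests on the existence of V*, which is the projection theorem
    for the range of an isometry ([isometry_closest]): a sequence z_n for which
    X z_n approaches the distance from y to the range is Cauchy, by the
    parallelogram law. *)

(** * Inner product inequalities *)

Section InnerProduct.
Variables (R : realType) (H : hilbertType R).
Implicit Types (x y t v : H) (a d e : R[i]).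

Lemma parallelogram x y :
  `|x - y| ^+ 2 + `|x + y| ^+ 2 = (`|x| ^+ 2 + `|y| ^+ 2) *+ 2.
Proof.
rewrite -!hdotE dnormB dnormD /=.
by rewrite addrACA addNr addr0 mulr2n.
Qed.

(** Moving t along v to the point nearest the origin lowers its squared norm by
    (|<t, v>| / |v|)^2, while no multiple of v can lower it by more than e^2.
    Both the Cauchy-Schwarz inequality (d = 0, e = |t|) and the orthogonality
    of the residual in the projection theorem come from this bound. *)
Lemma almost_closest_hdot t v d e : 0 <= e ->
  (forall a, d <= `|t - a *: v| ^+ 2) -> `|t| ^+ 2 <= d + e ^+ 2 ->
  `|hdot t v| <= e * `|v|.
Proof.
move=> e0 dP tP.
have [->|v0] := eqVneq v 0; first by rewrite linear0r !normr0 mulr0.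
have nv0 : `|v| != 0 by rewrite normr_eq0.
have nv_gt0 : 0 < `|v| by rewrite normr_gt0.
set p := hdot t v; pose s := `|p| / `|v|.
have s0 : 0 <= s by rewrite divr_ge0.
rewrite -ler_pdivrMr // -/s -(@ler_pXn2r _ 2) ?nnegrE //.
have := dP (p / `|v| ^+ 2); rewrite -hdotE dnormB dnormZ hdotE.
rewrite linearZr_LR /= !hdotE -/p.
have E : (p / `|v| ^+ 2)^* * p = s ^+ 2.
  rewrite rmorphM /= fmorphV rmorphXn /= (CrealP (normr_real _)).
  by rewrite mulrAC [_^* * p]mulrC -normCK expr_div_n.
have E' : `|p / `|v| ^+ 2| ^+ 2 * `|v| ^+ 2 = s ^+ 2.
  rewrite normf_div normrX normr_id -exprMn; congr (_ ^+ 2).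
  by rewrite /s; field.
rewrite E E' rmorphXn /= (CrealP (ger0_real s0)) => h.
rewrite -(lerD2l d); apply: le_trans tP.
have := lerD h (lexx (s ^+ 2)); congr (_ <= _); ring.
Qed.

Lemma cauchy_schwarz x y : `|hdot x y| <= `|x| * `|y|.
Proof.
by apply: (@almost_closest_hdot _ _ 0) => // *; rewrite ?exprn_ge0 ?add0r.
Qed.

End InnerProduct.

(** * Completeness and infima over R[i] *)

Section Convergence.
Variables (R : realType) (H : completeNormedModType R[i]).

(** The bound b need not be monotone: one index n with b n small already
    confines the whole tail of u to a small ball. *)
Lemma cauchy_seq_cvg (u : nat -> H) (b : nat -> R[i]) :
  (forall n k, `|u n - u (n + k)%N| <= b n) ->
  (forall e, 0 < e -> exists n, b n < e) ->
  exists l : H, u @ \oo --> l.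
Proof.
move=> ub b0; suff /cauchy_cvgP cu : cauchy (u @ \oo).
  by exists (lim (u @ \oo)).
apply: cauchy_exP => e /b0[n bn]; exists (u n).
exists n => // m /= nm; rewrite -ball_normE /=.
by rewrite -(subnKC nm); apply: le_lt_trans bn.
Qed.

Lemma complex_natSinv_lt (e : R[i]) : 0 < e -> exists n, n.+1%:R^-1 < e.
Proof.
case: e => e f; rewrite ltcE /= => /andP[/eqP-> e0].
have [n _ /(_ n (leqnn n)) h] := near_infty_natSinv_lt (PosNum e0).
exists n; have -> : n.+1%:R^-1 = (real_complex R n.+1%:R^-1)%R.
  by rewrite fmorphV rmorph_nat.
by rewrite (ltcR _ e).
Qed.

(** The order of R[i] is partial, but nonnegative numbers are real, so that the
    infimum can be taken of the real parts. *)
Lemma complex_inf (T : pointedType) (f : T -> R[i]) : (forall t, 0 <= f t) ->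
  exists d, (forall t, d <= f t) /\ forall e, 0 < e -> exists t, f t < d + e.
Proof.
move=> f0; pose g t := complex.Re (f t).
have fE t : f t = (real_complex R (g t)) by rewrite RRe_real // ger0_real.
have hi : has_inf (range g).
  split; first by exists (g point), point.
  by exists 0 => _ [t _ <-]; rewrite -(ler0c (g t)) -fE.
exists (real_complex R (inf (range g))); split=> [t|[e f1]].
  by rewrite fE lecR; apply: ge_inf; [exact: hi.2 | exists t].
rewrite ltcE /= => /andP[/eqP-> e0].
have [_ [t _ <-] h] := inf_adherent e0 hi.
by exists t; rewrite fE -[Complex e 0]/(real_complex R e) -rmorphD /= ltcR.
Qed.

End Convergence.

(** * The projection theorem for the range of an isometry *)

Section Closest.
Variables (R : realType).

Lemma eq0_small (s c : R[i]) : 0 <= s -> 0 <= c ->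
  (forall e, 0 < e -> s <= e * c) -> s = 0.
Proof.
move=> s0 c0 h; apply/eqP; apply/negP => /negP sN0.
have s_gt0 : 0 < s by rewrite lt_def sN0.
have c1 : 0 < c + 1 by rewrite ltr_wpDl.
have := h (s / (c + 1)) (divr_gt0 s_gt0 c1).
by rewrite mulrAC ler_pdivlMr // ler_pM2l // gerDl ler10.
Qed.

(** Orthogonal projection onto the range of X. Since X is isometric, the Cauchy
    property can be stated for the minimizing points z_n of H rather than for
    their images, so that completeness of H yields a limit inside the range. *)
Lemma isometry_closest (H K : hilbertType R) (X : {linear H -> K}) (y : K) :
  (forall x, `|X x| = `|x|) ->
  exists z, forall u, hdot (X u) (y - X z) = 0.
Proof.
move=> isoX; have f0 (z : H) : 0 <= `|y - X z| ^+ 2 by rewrite exprn_ge0.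
have [d [dP /(_ _ (exprn_gt0 2 _))dlt]] := complex_inf f0.
pose r n : R[i] := n.+1%:R^-1.
have r0 n : 0 < r n by rewrite invr_gt0 ltr0n.
have rB n m : (n <= m)%N -> r m <= r n.
  by move=> nm; rewrite /r lef_pV2 ?posrE ?ltr0n // ler_nat.
have [z zP] := choice (fun n => dlt _ (r0 n)).
(* With a and b the residuals at z n and z m, the parallelogram law bounds
     |b - a|^2 by 2 (|a|^2 + |b|^2) - 4 d, because half of a + b is a residual
     too. *)
have zC n k : `|z n - z (n + k)%N| <= r n *+ 2.
  set m := (n + k)%N.
  rewrite -(@ler_pXn2r _ 2) ?nnegrE ?mulrn_wge0 ?(ltW (r0 _)) //.
  pose a := y - X (z n); pose b := y - X (z m).
  have abB : `|z n - z m| = `|b - a|.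
    by rewrite -isoX linearB /b /a opprB [in RHS]addrC addrA subrK.
  have abD : d *+ 4 <= `|a + b| ^+ 2.
    have -> : a + b = 2%:R *: (y - X (2%:R^-1 *: (z n + z m))).
      rewrite linearZ /= scalerBr scalerA divff ?pnatr_eq0 // scale1r.
      by rewrite scaler_nat mulr2n linearD /a /b opprD addrACA.
    rewrite normrZ exprMn normr_nat -natrX mulr_natl.
    by rewrite lerMn2r dP.
  have rm : r m ^+ 2 <= r n ^+ 2.
    by rewrite lerXn2r ?nnegrE ?(ltW (r0 _)) // rB // leq_addr.
  have := parallelogram b a; rewrite -abB [b + a]addrC => E.
  have -> : `|z n - z m| ^+ 2 = (`|b| ^+ 2 + `|a| ^+ 2) *+ 2 - `|a + b| ^+ 2.
    by rewrite -E addrK.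
  rewrite lerBlDr.
  apply: (@le_trans _ _ ((d + r n ^+ 2 + (d + r n ^+ 2)) *+ 2)).
    rewrite lerMn2r; apply/orP; right; apply: lerD; last exact: ltW (zP n).
    by apply: le_trans (ltW (zP m)) _; rewrite lerD2l.
  apply: le_trans (lerD (lexx _) abD).
  by rewrite le_eqVlt; apply/orP; left; apply/eqP; ring.
have [|l lP] := cauchy_seq_cvg zC.
  move=> e e0; have [n h] := complex_natSinv_lt (divr_gt0 e0 (ltr0Sn _ 1)).
  by exists n; rewrite -mulr_natr -ltr_pdivlMr.
exists l => u; rewrite hdotC; apply/eqP; rewrite conjC_eq0 -normr_eq0.
apply/eqP.
apply: (@eq0_small _ (`|u| *+ 2)); rewrite ?mulrn_wge0 // => e e0.
have [n0 rn0] := complex_natSinv_lt e0.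
have [n1 _ n1P] := cvgr_dist_lt z l lP e e0.
pose n := maxn n0 n1; have {n1P} := n1P n (leq_maxr _ _).
rewrite /= => lz.
have -> : y - X l = (y - X (z n)) - X (l - z n).
  by rewrite linearB opprB addrA subrK.
rewrite linearBl /= mulr2n mulrDr.
apply: le_trans (ler_normB _ _) _; apply: lerD; last first.
  apply: le_trans (cauchy_schwarz _ _) _.
  by rewrite !isoX ler_wpM2r // ltW.
rewrite -(isoX u); apply: (@almost_closest_hdot _ _ _ _ d); first exact: ltW.
  by move=> a; rewrite -linearZ -addrA -opprD -linearD; apply: dP.
apply: le_trans (ltW (zP n)) _; rewrite lerD2l.
rewrite lerXn2r ?nnegrE ?(ltW (r0 _)) ?(ltW e0) //.
by apply: le_trans (rB _ _ (leq_maxl n0 n1)) _; apply: ltW.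
Qed.

End Closest.

(** * Adjoint and wandering projection of an isometry *)

Section IsometryAdjoint.
Variables (R : realType) (H : hilbertType R) (V : {linear H -> H}).
Hypothesis isoV : isometric V.

Lemma hdot_injr (x y : H) : (forall z, hdot z x = hdot z y) -> x = y.
Proof.
by move=> xy; apply/eqP; rewrite -subr_eq0; apply/eqP/hdot_eq0;
   rewrite linearBr /= xy subrr.
Qed.

Lemma hdot_adjoint (x y : H) : hdot (V x) y = hdot x (adjoint V y).
Proof.
have [z zP] := isometry_closest y isoV.
suff h : exists z, forall x, hdot (V x) y = hdot x z by exact: (xgetPex 0 h x).
exists z => u; rewrite -(isometric_hdot isoV u z); apply/eqP.
by rewrite -subr_eq0; have := zP u; rewrite linearBr => /= ->.
Qed.

Lemma adjointK x : adjoint V (V x) = x.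
Proof.
by apply: hdot_injr => z; rewrite -hdot_adjoint isometric_hdot.
Qed.

Lemma adjoint_linear a x y :
  adjoint V (a *: x + y) = a *: adjoint V x + adjoint V y.
Proof.
apply: hdot_injr => z; rewrite -hdot_adjoint !linearDr !linearZr_LR /=.
by rewrite !hdot_adjoint.
Qed.

(** The orthogonal projection onto the wandering space of V. *)
Definition wproj x := x - V (adjoint V x).

Lemma wproj_linear a x y : wproj (a *: x + y) = a *: wproj x + wproj y.
Proof.
rewrite /wproj adjoint_linear linearD linearZ /= scalerBr opprD.
by rewrite addrACA.
Qed.

Lemma wproj_wandering x : wandering V (wproj x).
Proof.
by move=> _ [y _ <-]; rewrite hdotC /wproj linearBr /= hdot_adjoint
  isometric_hdot // subrr conjC0.
Qed.

Lemma adjoint_wandering w : wandering V w -> adjoint V w = 0.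
Proof.
move=> wW; apply: hdot_injr => z; rewrite -hdot_adjoint linear0r hdotC.
by rewrite wW ?conjC0 //; exists z.
Qed.

(** Polarized Pythagoras for the splitting of H into the wandering space and
    the range of V. *)
Lemma hdot_wproj x y :
  hdot x y = hdot (wproj x) (wproj y) + hdot (adjoint V x) (adjoint V y).
Proof.
rewrite -{1}(subrK (V (adjoint V x)) x) -/(wproj x) linearDl /=.
rewrite hdot_adjoint; congr (_ + _).
rewrite [wproj y]/wproj linearBr /= (_ : hdot _ (V _) = 0) ?subr0 //.
by apply: wproj_wandering; exists (adjoint V y).
Qed.

Lemma norm_iter_adjoint n x : `|iter n (adjoint V) x| <= `|x|.
Proof.
elim: n => //= n; apply: le_trans; set y := iter n _ x.
rewrite -(@ler_pXn2r _ 2) ?nnegrE // -!hdotE [leRHS]hdot_wproj.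
by rewrite lerDr dnorm_ge0.
Qed.

Hypothesis pureV : pure V.

Lemma pure_small x e : 0 < e -> exists n, `|iter n (adjoint V) x| < e.
Proof.
by move=> e0; have [n _ h] := cvgr0_norm_lt _ (pureV x) _ e0;
   exists n; apply: (h n) => /=.
Qed.

(** The form in which purity turns identities that are invariant under
    x |-> V* x into statements about x itself. *)
Lemma pure_eq0 x s c : 0 <= s -> 0 <= c ->
  (forall n, s <= `|iter n (adjoint V) x| * c) -> s = 0.
Proof.
move=> s0 c0 h; apply: (eq0_small s0 c0) => e /(pure_small x)[n xn].
by apply: le_trans (h n) _; rewrite ler_wpM2r // ltW.
Qed.

End IsometryAdjoint.
Arguments wproj {R H}.

(** * Extending a unitary between wandering spaces *)

Section WoldExtension.
Variables (R : realType) (H H' : hilbertType R).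
Variables (V : {linear H -> H}) (V' : {linear H' -> H'}).
Hypotheses (isoV : isometric V) (isoV' : isometric V').
Hypotheses (pureV : pure V) (pureV' : pure V').

(** D x differs from D (V V* x) = V' (D (V* x)) by the value of D on a
    wandering vector, so that |D x| = |D (V*^n x)| for all n. *)
Lemma intertwiner_eq0 (D : {linear H -> H'}) c : 0 <= c ->
  (forall x, `|D x| <= `|x| * c) ->
  (forall x, D (V x) = V' (D x)) ->
  (forall w, wandering V w -> D w = 0) -> forall x, D x = 0.
Proof.
move=> c0 Dc DV D0 x; apply/eqP; rewrite -normr_eq0; apply/eqP.
apply: (pure_eq0 pureV (x := x) (normr_ge0 _) c0) => n.
suff -> : `|D x| = `|D (iter n (adjoint V) x)| by [].
elim: n => //= n ->; set y := iter n _ x.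
rewrite -{1}(subrK (V (adjoint V y)) y) linearD D0 ?add0r ?DV ?isoV' //.
exact: wproj_wandering.
Qed.

Variable Z : H -> H'.
Hypothesis unitZ : unitary_between (wandering V) (wandering V') Z.

Let ZD a x y : wandering V x -> wandering V y ->
  Z (a *: x + y) = a *: Z x + Z y.
Proof. by case: unitZ => + _ _; apply. Qed.

Let Zdot x y : wandering V x -> wandering V y -> hdot (Z x) (Z y) = hdot x y.
Proof. by case: unitZ => _ + _; apply. Qed.

Let ZW w : wandering V w -> wandering V' (Z w).
Proof. by case: unitZ => _ _ <- wW; exists w. Qed.

Let Z0 : Z 0 = 0.
Proof.
have W0 : wandering V 0 by move=> y _; rewrite linear0l.
by apply/hdot_eq0; rewrite Zdot // linear0l.
Qed.

(** The sum over k < n of V'^k Z P V*^k x, bracketed as in Horner's scheme: the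
    recursion through V* x makes properties of the sum provable by induction on
    n, for all x at once. *)
Fixpoint wold_sum n x :=
  if n is m.+1 then Z (wproj V x) + V' (wold_sum m (adjoint V x)) else 0.

Lemma wold_sum_linear n : linear (wold_sum n).
Proof.
elim: n => [|n IHn] a x y /=; first by rewrite scaler0 addr0.
rewrite wproj_linear //.
rewrite (ZD _ (wproj_wandering isoV x) (wproj_wandering isoV y)).
rewrite adjoint_linear // IHn linearD linearZ /= scalerDr.
by rewrite addrACA.
Qed.

Lemma hdot_wold_step p q u v : wandering V p -> wandering V q ->
  hdot (Z p + V' u) (Z q + V' v) = hdot p q + hdot u v.
Proof.
move=> pW qW.
have ort w t : wandering V w -> hdot (Z w) (V' t) = 0.
  by move=> wW; apply: ZW => //; exists t.
rewrite linearDl !linearDr /= ort // [hdot (V' u) (Z _)]hdotC ort // conjC0.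
by rewrite Zdot // (isometric_hdot isoV' u v) addr0 add0r.
Qed.

Lemma hdot_wold_sum n x y : hdot (wold_sum n x) (wold_sum n y) +
  hdot (iter n (adjoint V) x) (iter n (adjoint V) y) = hdot x y.
Proof.
elim: n x y => [|n IHn] x y; first by rewrite /= linear0l add0r.
rewrite !iterSr /= hdot_wold_step; try exact: wproj_wandering.
by rewrite -addrA IHn -hdot_wproj.
Qed.

Lemma norm_wold_sum n x : `|wold_sum n x| <= `|x|.
Proof.
rewrite -(@ler_pXn2r _ 2) ?nnegrE // -!hdotE -[leRHS](hdot_wold_sum n).
by rewrite lerDl dnorm_ge0.
Qed.

Lemma wold_sum_tail n k x :
  `|wold_sum n x - wold_sum (n + k)%N x| <= `|iter n (adjoint V) x|.
Proof.
elim: n x => [|n IHn] x; first by rewrite sub0r normrN norm_wold_sum.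
by rewrite iterSr /= opprD addrACA subrr add0r -linearB isoV'.
Qed.

Lemma isometry_cvg (u : nat -> H') l : u @ \oo --> l -> V' \o u @ \oo --> V' l.
Proof.
move=> ul; apply/cvgrPdist_lt => e e0.
apply: filterS (cvgr_dist_lt u l ul e e0) => n /=.
by rewrite -linearB isoV'.
Qed.

(** Everything about the limit X of the partial sums follows from the equation
    X x = Z P x + V' X V* x obtained by passing to the limit in the recursion,
    together with a rough bound on |X x|. *)
Lemma wold_extension : exists X : {linear H -> H'},
  [/\ unitary_between setT setT X, forall x, X (V x) = V' (X x) &
      forall w, wandering V w -> X w = Z w].
Proof.
have /choice[X XP] x : exists l : H', wold_sum n x @[n --> \oo] --> l.
  apply: (cauchy_seq_cvg (b := fun n => `|iter n (adjoint V) x|)) => [n k|e e0].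
    exact: wold_sum_tail.
  exact: pure_small.
have X_linear : linear X.
  move=> a x y; apply: (cvg_unique (@norm_hausdorff _ _) (XP _)).
  have -> : (fun n => wold_sum n (a *: x + y)) =
            (fun n => a *: wold_sum n x + wold_sum n y).
    by apply/funext => n; rewrite wold_sum_linear.
  by apply: cvgD; [apply: cvgZl_tmp; exact: XP | exact: XP].
pose XL : {linear H -> H'} :=
  HB.pack X (GRing.isLinear.Build _ _ _ _ X X_linear).
have X0 : X 0 = 0 := linear0 XL.
have X_rec x : X x = Z (wproj V x) + V' (X (adjoint V x)).
  have := XP x; rewrite -cvg_shiftS => XPx.
  apply: (cvg_unique (@norm_hausdorff _ _) XPx).
  apply: cvgD; first exact: cvg_cst.
  exact/isometry_cvg/XP.
have X_bound x : `|X x| <= `|x| *+ 2.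
  have [->|x0] := eqVneq x 0; first by rewrite X0 !normr0 mul0rn.
  have nx : 0 < `|x| by rewrite normr_gt0.
  have [n _ /(_ n (leqnn n)) /= h] := cvgr_dist_lt _ _ (XP x) _ nx.
  rewrite -[X x](subrK (wold_sum n x)) (le_trans (ler_normD _ _)) // mulr2n.
  by rewrite lerD ?norm_wold_sum // ltW.
have X_dot x y : hdot (X x) (X y) = hdot x y.
  (* The summands Z P x, Z P y contribute equally to both inner products. *)
  have stepn n : hdot (X x) (X y) - hdot x y =
      hdot (X (iter n (adjoint V) x)) (X (iter n (adjoint V) y)) -
      hdot (iter n (adjoint V) x) (iter n (adjoint V) y).
    elim: n => // n ->; set s := iter n _ x; set t := iter n _ y.
    rewrite [X s]X_rec [X t]X_rec [hdot s t](hdot_wproj isoV).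
    rewrite hdot_wold_step; try exact: wproj_wandering.
    by rewrite opprD addrACA subrr add0r.
  apply/eqP; rewrite -subr_eq0 -normr_eq0; apply/eqP.
  (* The 5 is 2 * 2 + 1, from |X s| |X t| + |s| |t| with |X s| <= 2 |s|. *)
  apply: (pure_eq0 pureV (x := x) (c := `|y| *+ 5)) => // n.
  rewrite (stepn n); set s := iter n _ x; set t := iter n _ y.
  have ty : `|t| <= `|y| by exact: norm_iter_adjoint.
  apply: le_trans (ler_normB _ _) _.
  apply: le_trans (lerD (cauchy_schwarz _ _) (cauchy_schwarz _ _)) _.
  apply: (@le_trans _ _ ((`|s| *+ 2) * (`|t| *+ 2) + `|s| * `|t|)).
    by rewrite lerD2r ler_pM.
  have -> : (`|s| *+ 2) * (`|t| *+ 2) + `|s| * `|t| = `|s| * (`|t| *+ 5).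
    by ring.
  by rewrite ler_wpM2l // lerMn2r ty.
have XV x : X (V x) = V' (X x).
  by rewrite X_rec /wproj adjointK // subrr Z0 add0r.
have XW w : wandering V w -> X w = Z w.
  move=> wW; rewrite X_rec /wproj adjoint_wandering // X0.
  by rewrite !linear0 !addr0.
exists XL; split=> //; split=> [a x y _ _|x y _ _|]; rewrite ?linearP //=.
apply/seteqP; split=> // y _.
have isoX x : `|XL x| = `|x|.
  by apply/eqP; rewrite -(@eqrXn2 _ 2) // -!hdotE X_dot.
(* Let t be the component of y orthogonal to the range of X.  Then V'* t is
   orthogonal to it as well, and P' t = 0 since P' t lies in W' = X W; hence
   t = V' V'* t, and inductively |t| = |V'*^n t|. *)
have [z zP] := isometry_closest y isoX.
exists z => //; apply/esym/eqP; rewrite -subr_eq0 -normr_eq0; apply/eqP.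
set t := y - XL z in zP *; suff nt : forall n,
    `|t| = `|iter n (adjoint V') t| /\
    forall u, hdot (X u) (iter n (adjoint V') t) = 0.
  apply: (pure_eq0 pureV' (x := t) (c := 1)) => // n.
  by rewrite mulr1 -(nt n).1.
elim=> [//|n [tn Xn]]; rewrite tn /=; move: (iter n _ t) Xn => s Xs.
split=> [|u]; last by rewrite -hdot_adjoint // -XV.
suff s0 : wproj V' s = 0.
  by rewrite -{1}(subrK (V' (adjoint V' s)) s) -/(wproj V' s) s0 add0r isoV'.
have sW := wproj_wandering isoV' s.
apply: hdot_eq0; rewrite {2}/wproj linearBr /= [X in _ - X](_ : _ = 0) ?subr0.
  case: unitZ => _ _ ZE; move: sW; rewrite -ZE => -[w wW <-].
  by rewrite -XW.
by apply: sW; exists (adjoint V' s).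
Qed.

End WoldExtension.

(** * The wandering space of a product of commuting isometries *)

Section CommutingPair.
Variables (R : realType) (H : hilbertType R) (V1 V2 : {linear H -> H}).
Hypotheses (iso1 : isometric V1) (iso2 : isometric V2).
Hypothesis comm : V1 \o V2 =1 V2 \o V1.

Lemma isometric_comp : isometric (V1 \o V2).
Proof. by move=> x /=; rewrite iso1 iso2. Qed.

(** The values of C2 lie in W1 and those of C1 in V1 W2; both spaces are
    contained in W, as this lemma and the next one show. *)
Lemma W1_sub_W x : W1 V1 x -> W V1 V2 x.
Proof. by move=> xW _ [y _ <-]; apply: xW; exists (V2 y). Qed.

Lemma V1W2_sub_W x : W2 V2 x -> W V1 V2 (V1 x).
Proof.
by move=> xW _ [y _ <-]; rewrite isometric_hdot //; apply: xW; exists y.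
Qed.

Lemma W_decomp w : W V1 V2 w ->
  exists x1 x2, [/\ W1 V1 x1, W2 V2 x2 & w = V2 x1 + x2].
Proof.
move=> wW; exists (adjoint V2 w), (wproj V2 w); split.
- move=> _ [y _ <-]; rewrite -(isometric_hdot iso2).
  have -> : V2 (adjoint V2 w) = w - wproj V2 w by rewrite /wproj opprB subrKC.
  rewrite linearBl /= wW; last by exists y => //=; rewrite -[RHS]comm.
  by rewrite (wproj_wandering iso2) ?subrr //; exists (V1 y).
- exact: wproj_wandering.
- by rewrite /wproj subrKC.
Qed.

Lemma C1C2_W w : W V1 V2 w -> W V1 V2 (C1 V1 V2 w) /\ W V1 V2 (C2 V1 V2 w).
Proof.
move=> /W_decomp[x1 [x2 [x1W x2W ->]]]; rewrite C1E // C2E //.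
by split; [exact: V1W2_sub_W | exact: W1_sub_W].
Qed.

(** Together with the stability of W under C1 and C2, this recovers V1 on W from
    the product V and the operators C1, C2 alone. *)
Lemma V1_W w : W V1 V2 w -> V1 w = (V1 \o V2) (C2 V1 V2 w) + C1 V1 V2 w.
Proof.
move=> /W_decomp[x1 [x2 [x1W x2W ->]]]; rewrite C1E // C2E //.
by rewrite linearD.
Qed.

End CommutingPair.

(** * Unitary equivalence *)

Section UnitaryIntertwiner.
Variables (R : realType) (H H' : hilbertType R) (X : H -> H').
Hypothesis unitX : unitary_between setT setT X.

(** X preserves orthogonality and carries the range of V onto that of V'. *)
Lemma unitary_wandering (V : H -> H) (V' : H' -> H') :
  (forall x, X (V x) = V' (X x)) ->
  forall x, wandering V' (X x) <-> wandering V x.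
Proof.
move=> XV x; case: unitX => _ Xdot Xonto; split=> xW.
  by move=> _ [y _ <-]; rewrite -Xdot // XV; apply: xW; exists (X y).
move=> _ [y _ <-]; have [z _ <-] : (X @` setT) y by rewrite Xonto.
by rewrite -XV Xdot //; apply: xW; exists z.
Qed.

Lemma unitary_image_wandering (V : H -> H) (V' : H' -> H') :
  (forall x, X (V x) = V' (X x)) -> X @` wandering V = wandering V'.
Proof.
move=> XV; apply/seteqP; split=> [_ [x xW <-]|y yW].
  exact/(unitary_wandering XV).
have [x _ xy] : (X @` setT) y by case: unitX => _ _ ->.
by exists x => //; apply/(unitary_wandering XV); rewrite xy.
Qed.

End UnitaryIntertwiner.

Section Equivalence.
Variables (R : realType) (H H' : hilbertType R).
Variables (V1 V2 : {linear H -> H}) (V1' V2' : {linear H' -> H'}).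
Hypotheses (pureV : pure_pair V1 V2) (pureV' : pure_pair V1' V2').

Lemma wandering_equiv :
  unitarily_equivalent setT V1 V2 setT V1' V2' ->
  unitarily_equivalent (W V1 V2) (C1 V1 V2) (C2 V1 V2)
                       (W V1' V2') (C1 V1' V2') (C2 V1' V2').
Proof.
case: pureV pureV' => iso1 iso2 comm _ [iso1' iso2' comm' _].
case=> X [unitX /(_ _ I) XV1 /(_ _ I) XV2].
have XV x : X ((V1 \o V2) x) = (V1' \o V2') (X x) by rewrite /= XV1 XV2.
have [Xlin Xdot _] := unitX.
have decomp w : W V1 V2 w -> exists x1 x2,
    [/\ W1 V1 x1, W2 V2 x2, W1 V1' (X x1), W2 V2' (X x2) &
        w = V2 x1 + x2 /\ X w = V2' (X x1) + X x2].
  move=> /(W_decomp iso2 comm)[x1 [x2 [x1W x2W ->]]]; exists x1, x2.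
  split=> //; first by apply/(unitary_wandering unitX XV1).
    by apply/(unitary_wandering unitX XV2).
  by split=> //; have := Xlin 1 (V2 x1) x2 I I; rewrite !scale1r XV2.
exists X; split; first split=> [a x y _ _|x y _ _|].
- exact: Xlin.
- exact: Xdot.
- exact: unitary_image_wandering.
- by move=> w /decomp[x1 [x2 [? ? ? ? [-> ->]]]]; rewrite !C1E.
- by move=> w /decomp[x1 [x2 [? ? ? ? [-> ->]]]]; rewrite !C2E.
Qed.

Lemma pair_equiv :
  unitarily_equivalent (W V1 V2) (C1 V1 V2) (C2 V1 V2)
                       (W V1' V2') (C1 V1' V2') (C2 V1' V2') ->
  unitarily_equivalent setT V1 V2 setT V1' V2'.
Proof.
case: pureV pureV' => iso1 iso2 comm pV [iso1' iso2' comm' pV'].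
case=> Z [unitZ ZC1 ZC2].
have isoV := isometric_comp iso1 iso2; have isoV' := isometric_comp iso1' iso2'.
have [X [unitX XV XZ]] := wold_extension isoV isoV' pV pV' unitZ.
have isoX x : `|X x| = `|x|.
  have [_ Xdot _] := unitX.
  by apply/eqP; rewrite -(@eqrXn2 _ 2) // -!hdotE Xdot.
have XV1 x : X (V1 x) = V1' (X x).
  (* f vanishes on W, because X V1 w = V' Z C2 w + Z C1 w, and it intertwines
     V and V' because V1 commutes with V, and V1' with V'. *)
  pose f : {linear H -> H'} := (X \o V1) \- (V1' \o X).
  apply/eqP; rewrite -subr_eq0; apply/eqP; rewrite -[LHS]/(f x).
  apply: (@intertwiner_eq0 _ _ _ _ _ isoV isoV' pV f 2) => //.
  - move=> y /=; apply: le_trans (ler_normB _ _) _.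
    by rewrite isoX iso1 iso1' isoX mulr_natr mulr2n.
  - move=> y; have XVE z : X (V1 (V2 z)) = V1' (V2' (X z)) := XV z.
    have commE z : V1 (V2 z) = V2 (V1 z) := comm z.
    have commE' z : V1' (V2' z) = V2' (V1' z) := comm' z.
    by rewrite /f /= XVE [V1 (V2 y)]commE XVE [V1' (V2' (X y))]commE' !linearB.
  - move=> w wW; rewrite /f /= (V1_W iso2 comm wW) linearD XV.
    have [w1W w2W] := C1C2_W iso1 iso2 comm wW.
    rewrite !XZ // ZC1 // ZC2 //.
    rewrite -(V1_W iso2' comm') ?subrr //.
    by case: unitZ => _ _ <-; exists w.
(* For the second factor it suffices to compare images under V1'. *)
exists X; split=> // x _; apply/eqP; rewrite -subr_eq0 -normr_eq0.
rewrite -iso1' linearB -XV1 normr_eq0 subr_eq0; apply/eqP.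
exact: XV.
Qed.

End Equivalence.

Theorem theorem4p1 (R : realType) (H H' : hilbertType R)
    (V1 V2 : {linear H -> H}) (V1' V2' : {linear H' -> H'})
    (pureV : pure_pair V1 V2) (pureV' : pure_pair V1' V2') :
  unitarily_equivalent setT V1 V2 setT V1' V2' <->
  unitarily_equivalent (W V1 V2) (C1 V1 V2) (C2 V1 V2)
                       (W V1' V2') (C1 V1' V2') (C2 V1' V2').
Proof. by split; [exact: wandering_equiv | exact: pair_equiv]. Qed.
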